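(* Let $S$ be an idempotent semifield and let $n\geq 1$. Let $UT_n(S^* )$ be the semigroup of upper triangular $n\times n$ matrices over $S$ all of whose entries on and above the diagonal are non-zero, and let $U_n(S^* )$ be the semigroup of upper triangular $n\times n$ matrices over $S$ with all diagonal entries equal to $\mathbf{1}$ and all entries above the diagonal non-zero. Then $UT_n(S^* )$ and $U_n(S^* )$ are Fountain. Moreover, in $UT_n(S^* )$ (respectively, in $U_n(S^* )$) each $\widetilde{\mathcal{R}}$-class and each $\widetilde{\mathcal{L}}$-class contains a unique idempotent: the unique idempotent in the $\widetilde{\mathcal{R}}$-class of $A$ is $A^{(+)}$ and the unique idempotent in the $\widetilde{\mathcal{L}}$-class of $A$ is $A^{( * )}$.
   Context: An idempotent semifield is a commutative semiring $S$ with $x+x=x$ for all $x$, in which $S^*=S\setminus\{\mathbf{0}\}$ is an abelian group under multiplication with identity $\mathbf{1}$. The natural order is $a\leq b\iff a+b=b$; with it $S^*$ is a lattice ordered abelian group, $\mathbf{0}$ is the least element of $S$, and addition is least upper bound; $\bigwedge$ denotes greatest lower bound. For $x\in S^n$, $\mathrm{Supp}(x)$ is the set of indices of non-zero entries of $x$, and $A_{i,\star}$ is the $i$th row of $A$. For an $n\times n$ matrix $A$ over $S$ the matrix $A^{(+)}$ is defined by $$(A^{(+)})_{i,j}=\begin{cases}\bigwedge\{A_{i,k}A_{j,k}^{-1}: k\in\mathrm{Supp}(A_{j,\star})\} & \text{if } \emptyset\neq\mathrm{Supp}(A_{j,\star})\subseteq\mathrm{Supp}(A_{i,\star}),\\ \mathbf{0}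 & \text{otherwise.}\end{cases}$$ For upper triangular $X$, $\Delta(X)_{i,j}=X_{n-j+1,n-i+1}$ (reflection in the anti-diagonal), and $A^{( * )}:=\Delta\big((\Delta(A))^{(+)}\big)$. For a semigroup $T$: $a\,\widetilde{\mathcal{R}}\,b$ iff for all idempotents $e\in T$, $ea=a\Leftrightarrow eb=b$; $a\,\widetilde{\mathcal{L}}\,b$ iff for all idempotents $e\in T$, $ae=a\Leftrightarrow be=b$. $T$ is Fountain if every $\widetilde{\mathcal{R}}$-class and every $\widetilde{\mathcal{L}}$-class of $T$ contains an idempotent. *)

(* Defs.v *)
From HB Require Import structures.
From mathcomp Require Import all_classical.
From mathcomp Require Import all_boot all_order all_algebra.

Set Implicit Arguments.
Unset Strict Implicit.
Unset Printing Implicit Defensive.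

Import Order.TTheory GRing.Theory.

Local Open Scope ring_scope.

(* Nontriviality of the semiring is part of the notion: 1 is the identity of  *)
(* the group of nonzero elements, hence is nonzero. The value of sfinv at 0   *)
(* is unconstrained, and never used.                                          *)
HB.mixin Record ComNzSemiRing_isIdemSemifield S of GRing.ComNzSemiRing S := {
  sfinv : S -> S;
  sfaddxx : forall x : S, x + x = x;
  sfmulVx : forall x : S, x != 0 -> sfinv x * x = 1
}.

#[short(type="idemSemifieldType")]
HB.structure Definition IdemSemifield :=
  { S of ComNzSemiRing_isIdemSemifield S & GRing.ComNzSemiRing S }.

(* Alias of S carrying the natural order a <= b iff a + b = b.                *)
Definition natord (S : idemSemifieldType) : Type := S.

HB.instance Definition _ (S : idemSemifieldType) := Choice.on (natord S).

Section NaturalOrder.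
Variable S : idemSemifieldType.

Definition natle (x y : natord S) : bool := (x : S) + (y : S) == y.

Lemma natle_refl : reflexive natle.
Proof. by move=> x; rewrite /natle sfaddxx. Qed.

Lemma natle_anti : antisymmetric natle.
Proof. by move=> x y /andP[/eqP xy /eqP yx]; rewrite -xy addrC yx. Qed.

Lemma natle_trans : transitive natle.
Proof. by move=> y x z /eqP xy /eqP yz; rewrite /natle -yz addrA xy. Qed.

HB.instance Definition _ :=
  Order.Le_isPOrder.Build Order.default_display (natord S)
    natle_refl natle_anti natle_trans.

End NaturalOrder.

Section FountainSemigroups.
Variable T : semigroupType.
Implicit Types a b e : T.

Definition idempotent_elt e := (e * e)%g = e.

Definition Rtilde a b :=
  forall e, idempotent_elt e -> (e * a)%g = a <-> (e * b)%g = b.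

Definition Ltilde a b :=
  forall e, idempotent_elt e -> (a * e)%g = a <-> (b * e)%g = b.

Definition Fountain :=
  (forall a, exists e, idempotent_elt e /\ Rtilde a e) /\
  (forall a, exists e, idempotent_elt e /\ Ltilde a e).

End FountainSemigroups.

Arguments Fountain T : clear implicits.

Section Matrices.
Variables (S : idemSemifieldType) (n : nat).
Implicit Types A B X : 'M[S]_n.

Definition supp (x : 'rV[S]_n) : {set 'I_n} := [set k | x 0 k != 0]%SET.

(* [infimum x0 E] is the greatest lower bound of E for the natural order; x0  *)
(* is only a default value, for E empty or without greatest lower bound.      *)
Definition mxplus A : 'M[S]_n :=
  \matrix_(i, j)
    if (supp (row j A) != finset.set0)
       && (supp (row j A) \subset supp (row i A))
    then infimum (0 : natord S)
           [set (A i k * sfinv (A j k) : natord S)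
              | k in [set` supp (row j A)]]%classic
    else 0.

(* rev_ord is the 0-based version of i |-> n - i + 1.                         *)
Definition antitr X : 'M[S]_n := \matrix_(i, j) X (rev_ord j) (rev_ord i).

Definition mxstar A : 'M[S]_n := antitr (mxplus (antitr A)).

Definition triu A := [forall i : 'I_n, forall j : 'I_n, (j < i)%N ==> (A i j == 0)].

Definition in_UTstar A :=
  triu A && [forall i : 'I_n, forall j : 'I_n, (i <= j)%N ==> (A i j != 0)].

Definition in_Ustar A :=
  [&& triu A, [forall i, A i i == 1] &
      [forall i : 'I_n, forall j : 'I_n, (i < j)%N ==> (A i j != 0)]].

Definition UTstar := {A : 'M[S]_n | in_UTstar A}.
Definition Ustar := {A : 'M[S]_n | in_Ustar A}.

HB.instance Definition _ := SubChoice.on UTstar.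
HB.instance Definition _ := SubChoice.on Ustar.

Lemma in_UTstarP A :
  reflect ((forall i j : 'I_n, (j < i)%N -> A i j = 0) /\
           (forall i j : 'I_n, (i <= j)%N -> A i j != 0)) (in_UTstar A).
Proof.
apply: (iffP andP) => -[h1 h2]; split.
- by move=> i j ij; apply/eqP; move: h1 => /forallP/(_ i)/forallP/(_ j)/implyP; apply.
- by move=> i j ij; move: h2 => /forallP/(_ i)/forallP/(_ j)/implyP; apply.
- by do 2!apply/forallP => ?; apply/implyP => /h1 ->.
- by do 2!apply/forallP => ?; apply/implyP => /h2.
Qed.

Lemma in_UstarP A :
  reflect (in_UTstar A /\ forall i, A i i = 1) (in_Ustar A).
Proof.
apply: (iffP and3P) => [[h1 /forallP h2 h3]|[/andP[h1 h2] h3]].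
  split=> [|i]; last by apply/eqP.
  apply/andP; split=> //; do 2!apply/forallP => ?; apply/implyP.
  rewrite leq_eqVlt => /orP[/eqP/val_inj <-|]; last first.
    by move: h3 => /forallP/(_ _)/forallP/(_ _)/implyP; apply.
  by rewrite (eqP (h2 _)) oner_neq0.
split=> //; first by apply/forallP => i; rewrite h3.
do 2!apply/forallP => ?; apply/implyP => /ltnW.
by move: h2 => /forallP/(_ _)/forallP/(_ _)/implyP; apply.
Qed.

Lemma sfaddr_eq0 (x y : S) : (x + y == 0) = (x == 0) && (y == 0).
Proof.
apply/eqP/andP => [xy0|[/eqP-> /eqP->]]; last by rewrite addr0.
have x0 : x = 0 by rewrite -[LHS]addr0 -xy0 addrA sfaddxx.
by move: xy0; rewrite x0 add0r => ->.
Qed.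

Lemma sfmulr_neq0 (x y : S) : x != 0 -> y != 0 -> x * y != 0.
Proof.
move=> x0; apply: contraNneq => xy0.
by rewrite -[y]mul1r -(sfmulVx x x0) -mulrA xy0 mulr0.
Qed.

Lemma in_UTstar_mul A B : in_UTstar A -> in_UTstar B -> in_UTstar (A *m B).
Proof.
move=> /in_UTstarP[A0 An] /in_UTstarP[B0 Bn]; apply/in_UTstarP; split=> i j ij.
  rewrite mxE big1 // => k _; have [ki|ik] := ltnP k i; first by rewrite A0 ?mul0r.
  by rewrite B0 ?mulr0 // (leq_trans ij).
by rewrite mxE (bigD1 i) //= sfaddr_eq0 negb_and sfmulr_neq0 ?An ?Bn.
Qed.

Lemma in_Ustar_mul A B : in_Ustar A -> in_Ustar B -> in_Ustar (A *m B).
Proof.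
move=> /in_UstarP[hA A1] /in_UstarP[hB B1]; apply/in_UstarP; split.
  exact: in_UTstar_mul.
move=> i; rewrite mxE (bigD1 i) //= A1 B1 mulr1 big1 ?addr0 // => k ki.
move/in_UTstarP: hA => [A0 _]; move/in_UTstarP: hB => [B0 _].
have [ik|ik|/val_inj ik] := ltngtP k i; first by rewrite A0 ?mul0r.
  by rewrite B0 ?mulr0.
by rewrite ik eqxx in ki.
Qed.

Definition UTstar_mul (A B : UTstar) : UTstar :=
  exist _ (val A *m val B) (in_UTstar_mul (valP A) (valP B)).

Definition Ustar_mul (A B : Ustar) : Ustar :=
  exist _ (val A *m val B) (in_Ustar_mul (valP A) (valP B)).

Lemma UTstar_mulA : associative UTstar_mul.
Proof. by move=> A B C; apply: val_inj; rewrite /= mulmxA. Qed.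

Lemma Ustar_mulA : associative Ustar_mul.
Proof. by move=> A B C; apply: val_inj; rewrite /= mulmxA. Qed.

HB.instance Definition _ := isSemigroup.Build UTstar UTstar_mulA.
HB.instance Definition _ := isSemigroup.Build Ustar Ustar_mulA.

End Matrices.

(* Main.v *)
Require Import Defs.
From HB Require Import structures.
From mathcomp Require Import all_classical.
From mathcomp Require Import all_boot all_order all_algebra.

(** The key is a residuation: for matrices [X] and [A] of UT_n(S^* ), the
    entrywise inequality [X *m A <= A] holds exactly when [X <= mxplus A]
    ([mulmx_le_mxplus]), because [x * A j k <= A i k] can be
    solved for [x] as soon as [A j k] is nonzero, and the infimum defining
    [mxplus A] collects these bounds.

    An idempotent of UT_n(S^* ) has idempotent nonzero diagonal entries, so its
    diagonal is 1; hence [A <= F *m A] for every idempotent [F], and [F] fixes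
    [A] on the left exactly when [F <= mxplus A] ([mulmx_fix]).  So the
    R-tilde-class of [A] is determined by [mxplus A].  The matrix
    [E := mxplus A] has diagonal 1, and residuation applied to [E] gives
    [E *m A = A], then [E *m E <= E], so that [E] is idempotent
    ([mxplus_idem]).  Finally [mxplus E = E] for an idempotent [E]
    ([mxplus_id]): so [E] is R-tilde-related to [A], and two R-tilde-related
    idempotents, being equal to their own [mxplus], are below each other and
    therefore equal.

    The idempotents involved all lie in U_n(S^* ), so one argument settles both
    semigroups ([unique_idempotent]).  Reflection in the anti-diagonal reverses
    products and preserves both semigroups, which exchanges the two sides and
    gives the statement on L-tilde. *)

Section Proof.

Set Implicit Arguments.
Unset Strict Implicit.
Unset Printing Implicit Defensive.
Import Order.TTheory GRing.Theory.
Local Open Scope ring_scope.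

Local Notation "x ≼ y" := (natle x y) (at level 70, no associativity).

(** * The natural order of an idempotent semifield *)

Section Order.
Variable S : idemSemifieldType.
Implicit Types x y z : S.

Lemma natleD x y z : (x + y ≼ z) = (x ≼ z) && (y ≼ z).
Proof.
apply/idP/andP => [/eqP xyz|[/eqP xz /eqP yz]]; last first.
  by rewrite /natle -addrA yz xz.
rewrite /natle -xyz; split; first by rewrite !addrA sfaddxx.
by rewrite [x + y]addrC !addrA sfaddxx.
Qed.

Lemma natle_sum (I : finType) (P : pred I) (f : I -> S) z :
  (\sum_(k | P k) f k ≼ z) <-> (forall k, P k -> f k ≼ z).
Proof.
split=> [le_z k Pk|le_z].
  by move: le_z; rewrite (bigD1 k) //= natleD => /andP[].
by elim/big_ind: _ => // [|x y xz yz]; rewrite ?natleD ?xz // /natle add0r.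
Qed.

Lemma natleM2r x y z : x ≼ y -> x * z ≼ y * z.
Proof. by move=> /eqP xy; rewrite /natle -mulrDl xy. Qed.

Lemma sfinv_neq0 x : x != 0 -> sfinv x != 0.
Proof.
move=> x0; apply: contraNneq (oner_neq0 S) => ix0.
by rewrite -(sfmulVx x x0) ix0 mul0r.
Qed.

Lemma natle_div x y z : z != 0 -> (x ≼ y * sfinv z) = (x * z ≼ y).
Proof.
move=> z0; apply/idP/idP => /(natleM2r _).
  by move=> /(_ z); rewrite -mulrA sfmulVx // mulr1.
by move=> /(_ (sfinv z)); rewrite -mulrA [z * _]mulrC sfmulVx // mulr1.
Qed.

Lemma natle_inv x y : x != 0 -> y != 0 -> (x ≼ sfinv y) = (y ≼ sfinv x).
Proof.
by move=> x0 y0; rewrite -[sfinv y]mul1r -[sfinv x]mul1r !natle_div // mulrC.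
Qed.

Lemma sfinvK x : x != 0 -> sfinv (sfinv x) = x.
Proof.
move=> x0; rewrite -[LHS]mulr1 -(sfmulVx x x0) mulrA sfmulVx ?mul1r //.
exact: sfinv_neq0.
Qed.

Lemma natle_eq x y : (forall z, z ≼ x <-> z ≼ y) -> x = y.
Proof.
by move=> xy; apply: natle_anti; apply/andP; split; apply/xy/natle_refl.
Qed.

(** Inversion reverses the order of the nonzero elements, so the infimum of a
    finite family of them is the inverse of the sum of their inverses. *)
Lemma infimum_finite (I : finType) (K : {set I}) (f : I -> S) :
    K != finset.set0 -> (forall k, k \in K -> f k != 0) ->
  let m : S := infimum (0 : natord S)
             [set (f k : natord S) | k in [set` K]]%classic in
  m != 0 /\ forall x, x ≼ m <-> forall k, k \in K -> x ≼ f k.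
Proof.
move=> /set0Pn[k0 Kk0] f0 m.
have invf0 : \sum_(k in K) sfinv (f k) != 0.
  by rewrite (bigD1 k0) //= sfaddr_eq0 negb_and sfinv_neq0 ?f0.
pose b := sfinv (\sum_(k in K) sfinv (f k)).
have bP x : x ≼ b <-> forall k, k \in K -> x ≼ f k.
  have [->|x0] := eqVneq x 0.
    by split=> _ *; rewrite /natle add0r.
  rewrite natle_inv // natle_sum; split=> h k Kk; have := h k Kk;
    by rewrite natle_inv ?sfinv_neq0 ?f0 // sfinvK ?f0.
suff -> : m = b by split; rewrite ?sfinv_neq0.
rewrite /m /infimum ifF; last first.
  by apply/negbTE/set0P; exists (f k0); exists k0.
apply: xget_unique => [|c [cl cg]]; first split.
- by move=> _ [k Kk <-]; by apply: (bP b).1 => //; apply: natle_refl.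
- move=> x xl; apply/bP => k Kk; apply: xl; by exists k.
apply: natle_anti; apply/andP; split.
  by apply/bP => k Kk; apply: cl; exists k.
by apply: cg => _ [k Kk <-]; by apply: (bP b).1 => //; apply: natle_refl.
Qed.

End Order.

(** * Residuation for upper triangular matrices *)

Section Residuation.
Variables (S : idemSemifieldType) (n : nat).
Implicit Types (A E F X Y : 'M[S]_n) (i j k : 'I_n).

Definition mxle X Y := forall i j, X i j ≼ Y i j.

Lemma mxle_refl X : mxle X X.
Proof. by move=> i j; apply: natle_refl. Qed.

Lemma mxle_anti X Y : mxle X Y -> mxle Y X -> X = Y.
Proof.
by move=> XY YX; apply/matrixP => i j; apply: natle_anti; rewrite XY YX.
Qed.

Lemma mulmx_le X Y A :
  mxle (X *m Y) A <-> forall i j k, X i j * Y j k ≼ A i k.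
Proof.
split=> [h i j k|h i k]; last by rewrite mxE; apply/natle_sum.
by have := h i k; rewrite mxE => /natle_sum; apply.
Qed.

Lemma le_mulmxl F A : (forall i, F i i = 1) -> mxle A (F *m A).
Proof.
move=> F1 i j; rewrite -[A i j]mul1r -(F1 i).
by apply: (mulmx_le F A (F *m A)).1; apply: mxle_refl.
Qed.

Lemma le_mulmxr F A : (forall i, F i i = 1) -> mxle A (A *m F).
Proof.
move=> F1 i j; rewrite -[A i j]mulr1 -(F1 j).
by apply: (mulmx_le A F (A *m F)).1; apply: mxle_refl.
Qed.

Lemma mem_supp_row A j k : in_UTstar A -> (k \in supp (row j A)) = (j <= k)%N.
Proof.
move=> /in_UTstarP[A0 An]; rewrite inE mxE.
by have [/An|/A0 ->] := leqP j k; rewrite ?eqxx.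
Qed.

Lemma mxplus_lower A i j : in_UTstar A -> (j < i)%N -> mxplus A i j = 0.
Proof.
move=> hA ji; rewrite mxE ifF //; apply/negbTE; rewrite negb_and; apply/orP.
right; apply/negP => /fintype.subsetP/(_ j).
by rewrite !mem_supp_row // leqnn leqNgt ji => /(_ isT).
Qed.

Lemma mxplus_upper A i j : in_UTstar A -> (i <= j)%N ->
  mxplus A i j != 0 /\
  forall x, x ≼ mxplus A i j <-> forall k, (j <= k)%N -> x * A j k ≼ A i k.
Proof.
move=> hA ij; have /in_UTstarP[_ An] := hA.
have s0 : supp (row j A) != finset.set0.
  by apply/set0Pn; exists j; rewrite mem_supp_row.
rewrite mxE s0 /= ifT; last first.
  by apply/fintype.subsetP => k; rewrite !mem_supp_row //; apply: leq_trans.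
have [k|m0 mP] := infimum_finite (f := fun k => A i k * sfinv (A j k)) s0.
  rewrite mem_supp_row // => jk.
  by rewrite sfmulr_neq0 ?sfinv_neq0 ?An // (leq_trans ij).
split=> // x; rewrite mP; split=> h k.
  by move=> jk; rewrite -natle_div ?An // h // mem_supp_row.
by rewrite mem_supp_row // => jk; rewrite natle_div ?An // h.
Qed.

Lemma mulmx_le_mxplus X A : in_UTstar X -> in_UTstar A ->
  mxle (X *m A) A <-> mxle X (mxplus A).
Proof.
move=> /in_UTstarP[X0 _] hA; have /in_UTstarP[A0 _] := hA.
rewrite mulmx_le; split=> h i j.
  have [ji|ij] := ltnP j i; first by rewrite X0 // /natle add0r.
  by apply/(mxplus_upper hA ij).2 => k _.
move=> k; have [ji|ij] := ltnP j i; first by rewrite X0 // mul0r /natle add0r.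
have [kj|jk] := ltnP k j; first by rewrite (A0 j) // mulr0 /natle add0r.
exact: ((mxplus_upper hA ij).2 _).1 (h i j) k jk.
Qed.

Lemma mulmx_diag X Y i : in_UTstar X -> in_UTstar Y ->
  (X *m Y) i i = X i i * Y i i.
Proof.
move=> /in_UTstarP[X0 _] /in_UTstarP[Y0 _].
rewrite mxE (bigD1 i) //= big1 ?addr0 // => k; rewrite -val_eqE /= => ki.
by case: ltngtP ki => // [/X0 ->|/Y0 ->] _; rewrite ?mul0r ?mulr0.
Qed.

(** A nonzero idempotent of S is 1, and this applies to the diagonal. *)
Lemma idempotent_in_Ustar F : in_UTstar F -> F *m F = F -> in_Ustar F.
Proof.
move=> hF FF; apply/in_UstarP; split=> // i; have /in_UTstarP[_ Fn] := hF.
have := congr1 (fun X : 'M[S]_n => sfinv (F i i) * X i i) FF.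
by rewrite /= mulmx_diag // mulrA sfmulVx ?Fn // mul1r.
Qed.

(** On the diagonal, the bounds [x * A i k <= A i k] for [i <= k] amount to
    [x <= 1], since [A i i] cancels in the bound for [k = i]. *)
Lemma mxplus_in_Ustar A : in_UTstar A -> in_Ustar (mxplus A).
Proof.
move=> hA; apply/in_UstarP; split.
  apply/in_UTstarP; split=> i j ij; first exact: mxplus_lower.
  by case: (mxplus_upper hA ij).
move=> i; have /in_UTstarP[_ An] := hA; apply: natle_eq => x.
rewrite (mxplus_upper hA (leqnn i)).2; split=> [/(_ i (leqnn i))|x1 k _].
  by rewrite -natle_div ?An // mulrC sfmulVx ?An.
by rewrite -[X in _ ≼ X]mul1r natleM2r.
Qed.

(** The unit diagonal of [F] makes [A <= F *m A] automatic, so that the equation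
    is an inequality, to which residuation applies. *)
Lemma mulmx_fix F A : in_Ustar F -> in_UTstar A ->
  F *m A = A <-> mxle F (mxplus A).
Proof.
move=> /in_UstarP[hF F1] hA; rewrite -mulmx_le_mxplus //; split=> [->|FA].
  exact: mxle_refl.
by apply: mxle_anti => //; apply: le_mulmxl.
Qed.

Lemma mxplus_mul A : in_UTstar A -> mxplus A *m A = A.
Proof.
move=> hA; apply/(mulmx_fix (mxplus_in_Ustar hA) hA).
exact: mxle_refl.
Qed.

(** The square of [mxplus A] still fixes [A], so residuation bounds it by
    [mxplus A]; the unit diagonal gives the other inequality. *)
Lemma mxplus_idem A : in_UTstar A -> mxplus A *m mxplus A = mxplus A.
Proof.
move=> hA; have hE := mxplus_in_Ustar hA.
apply: mxle_anti; last by apply: le_mulmxl; case/in_UstarP: hE.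
by apply/(mulmx_fix (in_Ustar_mul hE hE) hA); rewrite -mulmxA !mxplus_mul.
Qed.

(** [mxplus E <= E] because the unit diagonal of [E] gives
    [mxplus E <= mxplus E *m E], and [mxplus E] fixes [E]. *)
Lemma mxplus_id E : in_UTstar E -> E *m E = E -> mxplus E = E.
Proof.
move=> hE EE; have uE := idempotent_in_Ustar hE EE.
apply: mxle_anti; last exact/(mulmx_fix uE hE).
rewrite -[X in mxle _ X](mxplus_mul hE).
by apply: le_mulmxr; case/in_UstarP: uE.
Qed.

(** Both semigroups, and both sides, at once: [v] embeds the carrier [T] as a
    multiplicative set of matrices between U_n(S^* ) and UT_n(S^* ).  The
    multiplication is a bare operation so that the opposite of a semigroup,
    embedded by reflecting its matrices, is also covered. *)
Lemma unique_idempotent (T : Type) (mul : T -> T -> T) (v : T -> 'M[S]_n) :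
    injective v -> {morph v : x y / mul x y >-> x *m y} ->
    (forall x, in_UTstar (v x)) ->
    (forall X, in_Ustar X -> exists x, v x = X) ->
  forall a, exists2 e, v e = mxplus (v a) &
    unique (fun f => mul f f = f /\
      forall g, mul g g = g -> (mul g a = a <-> mul g f = f)) e.
Proof.
move=> v_inj vM vUT v_onto a.
have idem_fix g b : mul g g = g -> mul g b = b <-> mxle (v g) (mxplus (v b)).
  move=> gg; have vgg : v g *m v g = v g by rewrite -vM gg.
  rewrite -mulmx_fix ?idempotent_in_Ustar // -vM.
  by split=> [->|/v_inj].
have idem_plus g : mul g g = g -> mxplus (v g) = v g.
  by move=> gg; rewrite mxplus_id // -vM gg.
have [e ve] := v_onto _ (mxplus_in_Ustar (vUT a)).
have ee : mul e e = e by apply: v_inj; rewrite vM ve mxplus_idem.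
exists e => //; split; first split=> // g gg.
  have ge := idem_fix g e gg; rewrite (idem_plus e ee) ve in ge.
  exact: iff_trans (idem_fix g a gg) (iff_sym ge).
move=> f [ff af]; apply: v_inj; apply: mxle_anti.
  rewrite -(idem_plus f ff); apply/(idem_fix e f ee)/(af e ee).
  by apply/(idem_fix e a ee); rewrite ve; apply: mxle_refl.
by rewrite ve; apply/(idem_fix f a ff)/(af f ff).
Qed.

(** * Reflection in the anti-diagonal *)

Lemma antitrK : involutive (@antitr S n).
Proof. by move=> X; apply/matrixP => i j; rewrite !mxE !rev_ordK. Qed.

Lemma antitrM X Y : antitr (X *m Y) = antitr Y *m antitr X.
Proof.
apply/matrixP => i j; rewrite !mxE (reindex_inj rev_ord_inj) /=.
by apply: eq_bigr => k _; rewrite !mxE mulrC.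
Qed.

Lemma antitr_in_UTstar X : in_UTstar X -> in_UTstar (antitr X).
Proof.
have rev_ltn (i j : 'I_n) : (rev_ord i < rev_ord j)%N = (j < i)%N.
  by rewrite /= ltn_sub2lE.
move=> /in_UTstarP[X0 Xn]; apply/in_UTstarP; split=> i j ij; rewrite mxE.
  by rewrite X0 // rev_ltn.
by rewrite Xn // leqNgt rev_ltn -leqNgt.
Qed.

Lemma antitr_in_Ustar X : in_Ustar X -> in_Ustar (antitr X).
Proof.
move=> /in_UstarP[hX X1]; apply/in_UstarP; split=> [|i].
  exact: antitr_in_UTstar.
by rewrite mxE X1.
Qed.

Section Subsemigroup.
Variables (T : semigroupType) (v : T -> 'M[S]_n).
Hypotheses (v_inj : injective v)
  (vM : {morph v : x y / (x * y)%g >-> x *m y})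
  (vUT : forall x, in_UTstar (v x))
  (v_onto : forall X, in_Ustar X -> exists x, v x = X).

Lemma unique_Rtilde a : exists2 e, v e = mxplus (v a) &
  unique (fun f => idempotent_elt f /\ Rtilde a f) e.
Proof. exact: (unique_idempotent v_inj vM vUT v_onto a). Qed.

Lemma unique_Ltilde a : exists2 e, v e = mxstar (v a) &
  unique (fun f => idempotent_elt f /\ Ltilde a f) e.
Proof.
have [||||e ve eP] := @unique_idempotent T (fun x y => y * x)%g
  (fun x => antitr (v x)) _ _ _ _ a.
- by move=> x y /(can_inj antitrK)/v_inj.
- by move=> x y; rewrite vM antitrM.
- by move=> x; apply: antitr_in_UTstar.
- by move=> X /antitr_in_Ustar/v_onto[x vx]; exists x; rewrite vx antitrK.
by exists e; rewrite // /mxstar -ve antitrK.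
Qed.

Lemma Fountain_subsemigroup : Fountain T.
Proof.
by split=> a; [have [e _ [eP _]] := unique_Rtilde a
              | have [e _ [eP _]] := unique_Ltilde a]; exists e.
Qed.

End Subsemigroup.
End Residuation.
End Proof.

Theorem corollary4p19 (S : idemSemifieldType) (n : nat) (hn : (1 <= n)%N) :
  Fountain (UTstar S n) /\
  Fountain (Ustar S n) /\
  (forall A : UTstar S n,
    (exists2 E : UTstar S n, val E = mxplus (val A) &
       unique (fun F => idempotent_elt F /\ Rtilde A F) E) /\
    (exists2 E : UTstar S n, val E = mxstar (val A) &
       unique (fun F => idempotent_elt F /\ Ltilde A F) E)) /\
  (forall A : Ustar S n,
    (exists2 E : Ustar S n, val E = mxplus (val A) &
       unique (fun F => idempotent_elt F /\ Rtilde A F) E) /\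
    (exists2 E : Ustar S n, val E = mxstar (val A) &
       unique (fun F => idempotent_elt F /\ Ltilde A F) E)).
Proof.
have UT_in (A : UTstar S n) : in_UTstar (val A) by exact: valP.
have U_in (A : Ustar S n) : in_UTstar (val A).
  by have /in_UstarP[] := valP A.
have UT_onto X : in_Ustar X -> exists A : UTstar S n, val A = X.
  by case/in_UstarP => hX _; exists (exist _ X hX).
have U_onto X : in_Ustar X -> exists A : Ustar S n, val A = X.
  by move=> hX; exists (exist _ X hX).
have UT_M : {morph (val : UTstar S n -> _) : A B / (A * B)%g >-> (A *m B)%R}.
  by [].
have U_M : {morph (val : Ustar S n -> _) : A B / (A * B)%g >-> (A *m B)%R}.
  by [].
split.
  exact (@Fountain_subsemigroup _ _ (UTstar S n) val
    val_inj UT_M UT_in UT_onto).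
split.
  exact (@Fountain_subsemigroup _ _ (Ustar S n) val val_inj U_M U_in U_onto).
split=> A; split.
- exact (@unique_Rtilde _ _ (UTstar S n) val val_inj UT_M UT_in UT_onto A).
- exact (@unique_Ltilde _ _ (UTstar S n) val val_inj UT_M UT_in UT_onto A).
- exact (@unique_Rtilde _ _ (Ustar S n) val val_inj U_M U_in U_onto A).
- exact (@unique_Ltilde _ _ (Ustar S n) val val_inj U_M U_in U_onto A).
Qed.
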